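(* Let $\alpha\in[0,1)$ be irrational, let $h:\mathbb{T}^1\to\mathbb{T}^1$ be a homotopically trivial $C^\infty$ function, and let $T:\mathbb{T}^2\to\mathbb{T}^2$ be the skew product $T(x,y)=(x+\alpha,\,y+h(x))$. Then the measure complexity of $(\mathbb{T}^2,T,\rho)$ is sub-polynomial for every $T$-invariant Borel probability measure $\rho$ on $\mathbb{T}^2$.
   Context: $\mathbb{T}^1=\mathbb{R}/\mathbb{Z}$ and $\mathbb{T}^2=\mathbb{T}^1\times\mathbb{T}^1$. Measure complexity: let $X$ be a compact metrizable space, $T:X\to X$ a homeomorphism, $d$ a metric on $X$ compatible with the topology and $\rho$ a $T$-invariant Borel probability measure. For $n\in\mathbb{N}$ put $\overline{d}_n(x,y)=\frac1n\sum_{i=0}^{n-1}d(T^ix,T^iy)$ and $B_{\overline{d}_n}(x,\epsilon)=\{y\in X:\overline{d}_n(x,y)<\epsilon\}$. For $\epsilon>0$ let $$S_n(d,\rho,\epsilon)=\min\Big\{m\in\mathbb{N}:\exists x_1,\dots,x_m\in X\text{ such that }\rho\Big(\bigcup_{i=1}^mB_{\overline{d}_n}(x_i,\epsilon)\Big)>1-\epsilon\Big\}.$$ For an increasing $U:\mathbb{N}\to[1,+\infty)$ with $U(n)\to+\infty$, the measure complexity of $(X,T,\rho)$ is weaker than $U(n)$ if $\liminf_{n\to\infty}S_n(d,\rho,\epsilon)/U(n)=0$ for every $\epsilon>0$ (this does not depend on the choice of compatible metric $d$). The measure complexity of $(X,T,\rho)$ is sub-polynomial if it is weaker than $U_\tau(n)=n^\tau$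 for every $\tau>0$. *)

(* Defs.v *)
From HB Require Import structures.
From mathcomp Require Import all_boot all_order all_algebra.
From mathcomp Require Import generic_quotient ring_quotient.
From mathcomp Require Import all_classical all_reals all_analysis.

Set Implicit Arguments.
Unset Strict Implicit.
Unset Printing Implicit Defensive.

Import Order.TTheory GRing.Theory Num.Theory.
Import numFieldNormedType.Exports.

Local Open Scope classical_set_scope.
Local Open Scope ring_scope.

(* [Num.int] is a qualifier; the algebraic closure instances are attached to the
   underlying predicate. *)
Definition integers (R : realType) : zmodClosed R :=
  GRing.ZmodClosed.clone R Num.int_num_subdef _.

(* R/Z; the two nested quotients provide the topology and the group law. *)
Definition circle (R : realType) : Type :=
  quotient_topology (Quotient.quot (integers R)).

HB.instance Definition _ (R : realType) :=
  Quotient.copy (circle R) (quotient_topology (Quotient.quot (integers R))).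
HB.instance Definition _ (R : realType) := PointedTopological.copy (circle R)
  (quotient_topology (Quotient.quot (integers R))).
HB.instance Definition _ (R : realType) :=
  GRing.Zmodule.copy (circle R) (Quotient.quot (integers R)).

HB.instance Definition _ (X Y : ptopologicalType) := Pointed.on (X * Y)%type.

Definition circle_pi (R : realType) (x : R) : circle R := (\pi_(circle R) x)%qT.

(* The values of [H] at times outside [0, 1] are irrelevant. *)
Definition homotopic (R : realType) (X Y : topologicalType) (f g : X -> Y) :=
  exists H : R * X -> Y,
    [/\ {within `[0, 1] `*` [set: X], continuous H},
        forall x, H (0, x) = f x &
        forall x, H (1, x) = g x].

Definition homotopically_trivial (R : realType) (X Y : topologicalType)
    (f : X -> Y) :=
  exists c : Y, homotopic R f (cst c).

(* The charts of R/Z are the local inverses of the projection R -> R/Z, so a map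
   [h] is C^oo near the class of [x] iff [h] composed with the projection
   coincides near [x] with the projection of a real function [f] which is C^oo
   near [x]. *)
Definition circle_smooth (R : realType) (h : circle R -> circle R) :=
  forall x : R, exists f : R -> R,
    (\forall y \near x, h (circle_pi y) = circle_pi (f y)) /\
    (\forall y \near x, forall k : nat, derivable f^`(k)%classic y 1).

Record compatible_metric (R : realType) (X : topologicalType)
    (d : X -> X -> R) : Prop := CompatibleMetric {
  compatible_metric_ge0 : forall x y, 0 <= d x y ;
  compatible_metric_eq0 : forall x y, d x y = 0 <-> x = y ;
  compatible_metric_sym : forall x y, d x y = d y x ;
  compatible_metric_triangle : forall x y z, d x z <= d x y + d y z ;
  compatible_metric_nbhs : forall (x : X) (A : set X),
    nbhs x A <-> exists2 e : R, 0 < e & [set y | d x y < e] `<=` A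
}.

Definition borel (X : ptopologicalType) := g_sigma_algebraType (@open X).

Definition invariant_measure (R : realType) (X : ptopologicalType)
    (T : X -> X) (rho : probability (borel X) R) :=
  forall A : set (borel X), measurable A -> rho (T @^-1` A) = rho A.

Section measure_complexity.
Context (R : realType) (X : ptopologicalType).
Variables (T : X -> X) (d : X -> X -> R) (rho : probability (borel X) R).

Definition mean_dist (n : nat) (x y : X) : R :=
  n%:R^-1 * \sum_(i < n) d (iter i T x) (iter i T y).

Definition mean_ball (n : nat) (x : X) (e : R) : set X :=
  [set y | mean_dist n x y < e].

(* The minimum of a set of positive integers, taken in the extended reals so
   that it would be +oo, and not a junk natural number, on the empty set. *)
Definition complexity (n : nat) (e : R) : \bar R :=
  ereal_inf [set (m%:R)%:E | m in [set m : nat | (0 < m)%N /\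
    exists x : 'I_m -> X,
      ((1 - e)%:E < rho (\bigcup_i mean_ball n (x i) e))%E]].

End measure_complexity.

(* On a compact metrizable space the property does not depend on the choice of
   the compatible metric [d], over which the definition quantifies.
   The growth rate [U : nat -> R] and [complexity] are meaningful for
   positive [n] only; their values at 0 do not affect the lower limit. *)
Definition complexity_weaker (R : realType) (X : ptopologicalType)
    (T : X -> X) (rho : probability (borel X) R) (U : nat -> R) :=
  forall d : X -> X -> R, compatible_metric d ->
  forall e : R, 0 < e ->
    limn_einf (fun n => complexity T d rho n e * ((U n)^-1)%:E)%E = 0%E.

Definition sub_polynomial_complexity (R : realType) (X : ptopologicalType)
    (T : X -> X) (rho : probability (borel X) R) :=
  forall tau : R, 0 < tau -> complexity_weaker T rho (fun n => n%:R `^ tau).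

Definition skew_product (R : realType) (alpha : R) (h : circle R -> circle R)
    (p : circle R * circle R) : circle R * circle R :=
  (p.1 + circle_pi alpha, p.2 + h p.1).

(* Main.v *)
Require Import Defs.
From mathcomp Require Import all_boot all_order all_algebra.
From mathcomp Require Import generic_quotient ring_quotient.
From mathcomp Require Import all_classical all_reals all_analysis.
From mathcomp Require Import lra ring.
Import Order.TTheory GRing.Theory Num.Theory.
Import numFieldNormedType.Exports.

Set Implicit Arguments.
Unset Strict Implicit.
Unset Printing Implicit Defensive.

Local Open Scope classical_set_scope.
Local Open Scope ring_scope.

(** The bound on the complexity is purely topological: along a suitable
    sequence of times the whole torus is covered by few Bowen balls, so every
    invariant measure is handled at once.

    Since [h] is smooth and homotopically trivial, it is induced by a smooth
    1-periodic function [g : R -> R] ([smooth_real_lift]).  The [i]-th iterate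
    of the skew product then maps the class of [(x, y)] to the class of
    [(x + i alpha, y + S_i g x)], where [S_i g] is the Birkhoff sum of [g] over
    the rotation by [alpha].  Two points stay close up to time [n] as soon as
    their second coordinates are close and their first coordinates are close at
    the scale of the inverse of a common Lipschitz constant of the [S_i g],
    [i < n].  Everything rests on the following estimate
    ([birkhoff_lipschitz]): for each [N] there is [L] such that, for every
    coprime pair [p], [q] with [|q alpha - p| <= 1 / q], all the sums [S_i g]
    with [i <= q ^ N] are Lipschitz with constant [L q].  Hence [O(q)] balls
    are enough at time [q ^ N], and [q / (q ^ N) ^ tau] is at most [1 / q] when
    [N tau >= 2].  As [alpha] is irrational, Dirichlet's theorem provides such
    [q] beyond any bound ([dirichlet_large]), so the lower limit vanishes.

    The Lipschitz estimate says that the Birkhoff sums of [f = g'] are bounded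
    by [L q] up to time [q ^ N].  Let [A f] be the mean of [f] over the first
    [q] points of an orbit.  Replacing [f] by [A f] changes a Birkhoff sum of
    any length by at most [2 q |f|], since [f - A f] is an average of
    coboundaries ([norm_birkhoff_le_mean]).  On the other hand the first [q]
    points of an orbit are within [1 / q] of the points of an equidistributed
    grid, so if [f] has a periodic primitive, that is, mean zero, then
    [|A f| <= (2 / q) |f'|] ([norm_birkhoff_derivative_le]).  The operator [A]
    commutes with differentiation and [A f] again has a periodic primitive, so
    this gain can be repeated: [|A^N f| <= (2 / q) ^ N |f^(N)|].  Thus the sum of
    length [i <= q ^ N] is at most [2 q N |f| + 2 ^ N |f^(N)|]
    ([norm_birkhoff_tower_le]).

    The lift of [h] comes from the homotopy to a constant map.  It is cut into
    steps so short that consecutive maps never differ by a quarter turn or more;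
    the difference of two such maps has a continuous real-valued angle, given
    by the arctangent, and these angles add up to a lift of [h] that is defined
    on the circle, hence periodic on the line. *)

(** * Birkhoff sums over a rotation *)

Section birkhoff_sums.
Variable R : realType.
Implicit Types (a x y B M : R) (f g : R -> R) (n i j q p : nat).

Definition birkhoff a f n x : R := \sum_(j < n) f (x + j%:R * a).

Definition birkhoff_mean a n f x : R := n%:R^-1 * birkhoff a f n x.

Definition periodic1 f := forall x, f (x + 1) = f x.

Lemma periodic1_int f : periodic1 f -> forall x (m : int), f (x + m%:~R) = f x.
Proof.
move=> fP; have fN x n : f (x + n%:R) = f x.
  by elim: n => [|n IH]; rewrite ?addr0// -addn1 natrD addrA fP.
by move=> x [n|n]; rewrite ?fN// NegzE mulrNz -[in RHS](subrK n.+1%:R x) fN.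
Qed.

Lemma birkhoffD a f n i x :
  birkhoff a f (n + i) x = birkhoff a f n x + birkhoff a f i (x + n%:R * a).
Proof.
rewrite /birkhoff big_split_ord/=; congr (_ + _).
by apply: eq_bigr => j _; rewrite natrD mulrDl addrA.
Qed.

Lemma norm_birkhoff_le a f n x B : (forall y, `|f y| <= B) ->
  `|birkhoff a f n x| <= n%:R * B.
Proof.
move=> fB; rewrite (le_trans (ler_norm_sum _ _ _))//.
rewrite mulr_natl -[n in leRHS]card_ord -sumr_const; exact: ler_sum.
Qed.

Lemma norm_birkhoff_mean_le a f n B x : (0 < n)%N -> (forall y, `|f y| <= B) ->
  `|birkhoff_mean a n f x| <= B.
Proof.
move=> n0 fB; rewrite normrM ger0_norm ?invr_ge0// ler_pdivrMl ?ltr0n//.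
exact: norm_birkhoff_le.
Qed.

(** Moving the starting point by [j] steps along the orbit changes at most
    [2 j] terms of the sum, whatever its length. *)
Lemma norm_birkhoff_shift_le a f n j x B : (forall y, `|f y| <= B) ->
  `|birkhoff a f n x - birkhoff a f n (x + j%:R * a)| <= 2 * j%:R * B.
Proof.
move=> fB; have := birkhoffD a f n j x; rewrite addnC birkhoffD => E.
have -> : birkhoff a f n x - birkhoff a f n (x + j%:R * a) =
    birkhoff a f j x - birkhoff a f j (x + n%:R * a).
  by apply/eqP; rewrite subr_eq addrAC eq_sym subr_eq E.
have := norm_birkhoff_le a j x fB.
have := norm_birkhoff_le a j (x + n%:R * a) fB.
rewrite !ler_norml => /andP[? ?] /andP[? ?]; apply/andP; split; lra.
Qed.

Lemma birkhoff_birkhoff_mean a f q n x :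
  birkhoff a (birkhoff_mean a q f) n x =
  q%:R^-1 * \sum_(j < q) birkhoff a f n (x + j%:R * a).
Proof.
rewrite /birkhoff_mean /birkhoff -mulr_sumr exchange_big/=; congr (_ * _).
by apply: eq_bigr => i _; apply: eq_bigr => j _; rewrite addrAC.
Qed.

(** The function [f - birkhoff_mean a q f] is an average of differences between
    [f] and its translates by fewer than [q] steps; the Birkhoff sums of each of
    them telescope and so are bounded independently of [n]. *)
Lemma norm_birkhoff_le_mean a f q n x B : (0 < q)%N -> (forall y, `|f y| <= B) ->
  `|birkhoff a f n x| <= 2 * q%:R * B + `|birkhoff a (birkhoff_mean a q f) n x|.
Proof.
move=> q0 fB; have B0 : 0 <= B by rewrite (le_trans _ (fB 0)).
rewrite -lerBlDr (le_trans (lerB_dist _ _))//.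
have -> : birkhoff a f n x - birkhoff a (birkhoff_mean a q f) n x =
  q%:R^-1 * \sum_(j < q) (birkhoff a f n x - birkhoff a f n (x + j%:R * a)).
  rewrite birkhoff_birkhoff_mean sumrB sumr_const card_ord mulrBr; congr (_ - _).
  by rewrite -(mulr_natl (birkhoff _ _ _ _)) mulKf// pnatr_eq0 -lt0n.
rewrite normrM ger0_norm ?invr_ge0// ler_pdivrMl ?ltr0n//.
rewrite (le_trans (ler_norm_sum _ _ _))//.
rewrite [leRHS](_ : _ = \sum_(j < q) (2 * q%:R * B)); last first.
  by rewrite sumr_const card_ord [LHS]mulr_natl.
apply: ler_sum => j _.
rewrite (le_trans (norm_birkhoff_shift_le _ _ _ _ fB))// ler_wpM2r// ler_wpM2l//.
by rewrite ler_nat ltnW.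
Qed.

Lemma is_derive_birkhoff a f g n x : (forall y, is_derive y 1 f (g y)) ->
  is_derive x 1 (birkhoff a f n) (birkhoff a g n x).
Proof.
move=> fg; have -> : birkhoff a f n = \sum_(j < n) (f \o shift (j%:R * a)).
  by apply/funext => y; rewrite fct_sumE.
apply: is_derive_sum => j.
rewrite -[g _]mulr1; apply: (@is_derive1_comp _ f (shift (j%:R * a))).
exact: is_derive_shift.
Qed.

Lemma is_derive_birkhoff_mean a f g n x : (forall y, is_derive y 1 f (g y)) ->
  is_derive x 1 (birkhoff_mean a n f) (birkhoff_mean a n g x).
Proof.
move=> fg; apply: (@is_deriveZ _ _ _ (birkhoff a f n) (n%:R^-1)).
exact: is_derive_birkhoff.
Qed.

Lemma periodic1_birkhoff_mean a f n : periodic1 f -> periodic1 (birkhoff_mean a n f).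
Proof.
move=> fP x; congr (_ * _); apply: eq_bigr => j _; by rewrite addrAC fP.
Qed.

Lemma derive_MVT f g : (forall y, is_derive y 1 f (g y)) ->
  forall x y, x <= y -> exists2 c, x <= c <= y & f y - f x = g c * (y - x).
Proof.
move=> fg x y xy; have fc : {within `[x, y], continuous f}.
  by apply: derivable_within_continuous => z _; apply: ex_derive.
have [c] := MVT_segment xy (fun z _ => fg z) fc.
by rewrite in_itv/=; exists c.
Qed.

Lemma derive_lipschitz f g M : (forall y, is_derive y 1 f (g y)) ->
  (forall y, `|g y| <= M) -> forall x y, `|f x - f y| <= M * `|x - y|.
Proof.
move=> fg gM x y; wlog xy : x y / x <= y => [H|].
  by case: (leP x y) => [/H//|/ltW /H]; rewrite distrC (distrC y).
have [c _ E] := derive_MVT fg xy.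
by rewrite distrC E normrM distrC ler_wpM2r.
Qed.

(** The increment of a primitive over a short interval is [s] times a value of
    [f] inside the interval, and that value is [2 M s]-close to the value of [f]
    at any point [x + t] at distance at most [s] from [x]. *)
Lemma norm_quotient_le (F f f' : R -> R) (M s t x : R) :
  (forall y, is_derive y 1 F (f y)) -> (forall y, is_derive y 1 f (f' y)) ->
  (forall y, `|f' y| <= M) -> 0 < s -> `|t| <= s ->
  `|s * f (x + t) - (F (x + s) - F x)| <= 2 * M * s ^+ 2.
Proof.
move=> Ff ff' M' s0 ts.
have xs : x <= x + s by rewrite lerDl ltW.
have [c /andP[xc cx] ->] := derive_MVT Ff xs.
have -> : s * f (x + t) - f c * (x + s - x) = (f (x + t) - f c) * s by ring.
rewrite normrM (gtr0_norm s0) expr2 mulrA ler_wpM2r ?(ltW s0)//.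
have M0 : 0 <= M by rewrite (le_trans _ (M' 0)).
rewrite (le_trans (derive_lipschitz ff' M' _ _))// [2 * M]mulrC -mulrA ler_wpM2l//.
by move: ts; rewrite !ler_norml => /andP[? ?]; apply/andP; split; lra.
Qed.

(** Multiplication by a unit permutes the residues modulo [q]. *)
Lemma sum_modM (F : nat -> R) p q : (0 < q)%N -> coprime p q ->
  \sum_(j < q) F (j * p %% q)%N = \sum_(j < q) F j.
Proof.
case: q => // q _ pq.
pose h (j : 'I_q.+1) := inord (j * p %% q.+1)%N : 'I_q.+1.
have hE (j : 'I_q.+1) : h j = (j * p %% q.+1)%N :> nat by rewrite inordK ?ltn_pmod.
rewrite [RHS](reindex_inj (h := h)); first by apply: eq_bigr => j _; rewrite hE.
move=> i j; wlog ij : i j / (i <= j)%N => [H|/(congr1 (@nat_of_ord _))].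
  by case/orP: (leq_total i j) => ? hij; [exact: H|exact/esym/H/esym].
rewrite !hE => /esym/eqP; rewrite eqn_mod_dvd ?leq_mul2r ?ij ?orbT// -mulnBl.
rewrite Gauss_dvdl 1?coprime_sym// => /dvdn_leq ji; apply/val_inj/eqP => /=.
rewrite eqn_leq ij/= -subn_eq0 -leqn0 leqNgt; apply/negP => ji0.
by have := ji ji0; rewrite leqNgt ltnS (leq_trans (leq_subr _ _))// -ltnS.
Qed.

(** The points [x + j a] with [j < q] are, modulo 1 and up to [1 / q], the points
    [x + r / q] in another order, because [p] is invertible modulo [q].  Up to
    second order in [1 / q], [f (x + r / q) / q] is the increment of [F] on the
    [r]-th interval of the grid, and these increments add up to
    [F (x + 1) - F x = 0]. *)
Lemma norm_birkhoff_derivative_le (F f f' : R -> R) M a q p x :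
  periodic1 F -> periodic1 f ->
  (forall y, is_derive y 1 F (f y)) -> (forall y, is_derive y 1 f (f' y)) ->
  (forall y, `|f' y| <= M) ->
  (0 < q)%N -> coprime p q -> `|q%:R * a - p%:R| <= q%:R^-1 ->
  `|birkhoff a f q x| <= 2 * M.
Proof.
move=> FP fP Ff ff' M' q0 pq aq; set s : R := q%:R^-1.
have q0' : 0 < q%:R :> R by rewrite ltr0n.
have s0 : 0 < s by rewrite invr_gt0.
have qs : q%:R * s = 1 by rewrite mulfV ?gt_eqF.
pose D k := F (x + k%:R * s + s) - F (x + k%:R * s).
have D0 : \sum_(j < q) D j = 0.
  have -> : \sum_(j < q) D j = \sum_(0 <= j < q) (F (x + j.+1%:R * s) - F (x + j%:R * s)).
    by rewrite big_mkord; apply: eq_bigr => j _; rewrite /D -addrA -[j.+1]addn1 natrD mulrDl mul1r.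
  by rewrite telescope_sumr// qs FP mul0r addr0 subrr.
have fD (j : 'I_q) : `|s * f (x + j%:R * a) - D (j * p %% q)%N| <= 2 * M * s ^+ 2.
  have -> : f (x + j%:R * a) =
      f (x + (j * p %% q)%:R * s + j%:R * s * (q%:R * a - p%:R)).
    (* Translating by the integer part of [j p / q] leaves its residue modulo [q]. *)
    rewrite -[RHS](periodic1_int fP _ (j * p %/ q)%N); congr (f _).
    have E : j%:R * p%:R = (j * p %/ q)%:R * q%:R + (j * p %% q)%:R :> R.
      by rewrite -!natrM -natrD -divn_eq.
    have -> : (j * p %% q)%:R = j%:R * p%:R - (j * p %/ q)%:R * q%:R :> R.
      by rewrite E addrC addKr.
    rewrite -pmulrn [RHS](_ : _ = x + j%:R * a * (q%:R * s) +
      (j * p %/ q)%:R * (1 - q%:R * s)); last by ring.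
    by rewrite qs subrr mulr0 addr0 mulr1.
  apply: norm_quotient_le => //.
  rewrite normrM ger0_norm ?mulr_ge0 ?(ltW s0)//.
  rewrite (le_trans (ler_wpM2l _ aq)) ?mulr_ge0 ?(ltW s0)// -/s.
  rewrite -[leRHS]mul1r ler_pM2r// -[leRHS]qs ler_pM2r// ler_nat ltnW//.
have : `|\sum_(j < q) (s * f (x + j%:R * a) - D (j * p %% q)%N)| <= q%:R * (2 * M * s ^+ 2).
  rewrite (le_trans (ler_norm_sum _ _ _))//.
  rewrite [leRHS]mulr_natl -[q in leRHS]card_ord -sumr_const.
  exact: ler_sum.
rewrite sumrB (sum_modM D q0 pq) D0 subr0 -mulr_sumr normrM (gtr0_norm s0).
rewrite [leRHS](_ : _ = (q%:R * s) * (s * (2 * M))); last by ring.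
by rewrite qs mul1r ler_pM2l.
Qed.

(** Each replacement of [f] by its mean over [q] steps costs [2 q B] and gains a
    factor [2 / q] at the price of one more derivative.  The induction on the
    number of replacements runs over whole sequences [g] of successive
    derivatives: the means of such a sequence form another one, to which the
    induction hypothesis applies. *)
Lemma norm_birkhoff_tower_le a q p N (g : nat -> R -> R) B C i x :
  (0 < q)%N -> coprime p q -> `|q%:R * a - p%:R| <= q%:R^-1 ->
  (forall k, periodic1 (g k)) -> (forall k y, is_derive y 1 (g k) (g k.+1 y)) ->
  (forall y, `|g 1%N y| <= B) -> (forall y, `|g N.+1 y| <= C) ->
  `|birkhoff a (g 1%N) i x| <= 2 * q%:R * N%:R * B + i%:R * ((2 / q%:R) ^+ N * C).
Proof.
move=> q0 pq aq; elim: N g C => [|N IH] g C gP gD gB gC.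
  by rewrite mulr0 mul0r add0r expr0 mul1r norm_birkhoff_le.
rewrite (le_trans (norm_birkhoff_le_mean a i x q0 gB))//.
have := IH (fun k => birkhoff_mean a q (g k)) (2 / q%:R * C).
have gP' k : periodic1 (birkhoff_mean a q (g k)) by apply: periodic1_birkhoff_mean.
have gD' k y : is_derive y 1 (birkhoff_mean a q (g k)) (birkhoff_mean a q (g k.+1) y).
  exact: is_derive_birkhoff_mean.
have gB' y : `|birkhoff_mean a q (g 1%N) y| <= B by apply: norm_birkhoff_mean_le.
have gC' y : `|birkhoff_mean a q (g N.+1) y| <= 2 / q%:R * C.
  rewrite normrM ger0_norm ?invr_ge0// -mulrA mulrCA ler_wpM2l ?invr_ge0//.
  by apply: (@norm_birkhoff_derivative_le (g N) _ (g N.+2)) pq aq.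
move=> /(_ gP' gD' gB' gC') H.
rewrite exprS; lra.
Qed.
End birkhoff_sums.

(** * Rational approximation *)

Section dirichlet.
Variable R : realType.
Implicit Types (a x : R) (n q p : nat).

(** Two of the [n + 1] fractional parts of [j a], [j <= n], fall into the same
    interval of length [1 / n]. *)
Lemma dirichlet_pigeonhole a n : 0 <= a -> (0 < n)%N ->
  exists q p, [/\ (0 < q)%N, (q <= n)%N & `|q%:R * a - p%:R| < n%:R^-1].
Proof.
case: n => // n a0 _.
pose fr x := x - (Num.truncn x)%:R.
have fr01 x : 0 <= x -> 0 <= fr x < 1.
  by move=> /truncn_itv/andP[x0 x1]; rewrite subr_ge0 x0/= ltrBlDl natr1.
have ja0 j : 0 <= j%:R * a by rewrite mulr_ge0.
pose box (j : 'I_n.+2) : 'I_n.+1 := inord (Num.truncn (n.+1%:R * fr (j%:R * a))).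
have /injectivePn[j [k jk bjk]] : ~~ injectiveb box.
  by apply/negP => /injectiveP/leq_card; rewrite !card_ord ltnn.
wlog ltjk : j k jk bjk / (j < k)%N => [H|].
  case: (ltngtP j k) => [lt|lt|/val_inj jk']; last by rewrite jk' eqxx in jk.
    exact: (H j k).
  by apply: (H k j); rewrite // eq_sym.
have boxE (i : 'I_n.+2) : box i = Num.truncn (n.+1%:R * fr (i%:R * a)) :> nat.
  rewrite inordK// truncn_lt_nat; have /andP[f0 f1] := fr01 _ (ja0 i).
    by rewrite -[ltRHS]mulr1 ltr_pM2l.
  by rewrite mulr_ge0.
exists (k - j)%N, (Num.truncn (k%:R * a) - Num.truncn (j%:R * a))%N; split.
- by rewrite subn_gt0.
- by rewrite (leq_trans (leq_subr _ _))// -ltnS.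
have tjk : (Num.truncn (j%:R * a) <= Num.truncn (k%:R * a))%N.
  by apply: le_truncn; rewrite ler_wpM2r// ler_nat ltnW.
rewrite !natrB//; last exact: ltnW.
have -> : (k%:R - j%:R) * a - ((Num.truncn (k%:R * a))%:R - (Num.truncn (j%:R * a))%:R) =
   fr (k%:R * a) - fr (j%:R * a) by rewrite /fr; ring.
have t0 i : 0 <= n.+1%:R * fr (i%:R * a).
  by have /andP[f0 _] := fr01 _ (ja0 i); rewrite mulr_ge0.
have := truncn_itv (t0 j); have := truncn_itv (t0 k).
rewrite -!boxE bjk -[(box k).+1]addn1 natrD => /andP[k1 k2] /andP[j1 j2].
rewrite -(ltr_pM2l (_ : 0 < n.+1%:R :> R))// mulfV// -[X in X * _]ger0_norm// -normrM mulrBr.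
by rewrite ltr_norml; apply/andP; split; lra.
Qed.

(** Dividing [q] and [p] by their greatest common divisor also divides the error. *)
Lemma dirichlet_coprime a n : 0 <= a -> (0 < n)%N ->
  exists q p, [/\ (0 < q)%N, (q <= n)%N, coprime p q & `|q%:R * a - p%:R| < n%:R^-1].
Proof.
move=> a0 n0; have [q [p [q0 qn qp]]] := dirichlet_pigeonhole a0 n0.
have d0 : (0 < gcdn p q)%N by rewrite gcdn_gt0 q0 orbT.
have q'0 : (0 < q %/ gcdn p q)%N by rewrite divn_gt0// dvdn_leq// dvdn_gcdr.
exists (q %/ gcdn p q)%N, (p %/ gcdn p q)%N; split => //.
- by rewrite (leq_trans (leq_div _ _)).
- rewrite /coprime -(eqn_pmul2r d0) mul1n muln_gcdl !divnK ?dvdn_gcdl ?dvdn_gcdr//.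
apply: le_lt_trans qp.
move: (gcdn p q) d0 (divnK (dvdn_gcdl p q)) (divnK (dvdn_gcdr p q)) => d d0 pE qE.
rewrite -[in leRHS]pE -[in leRHS]qE !natrM mulrAC -mulrBl normrM [`|d%:R|]ger0_norm//.
by rewrite ler_peMr// ler1n.
Qed.

Lemma irrational_mul_nat_dist a q : 0 <= a -> irrational a -> (0 < q)%N ->
  exists2 e, 0 < e & forall p, e <= `|q%:R * a - p%:R|.
Proof.
move=> a0 airr q0; have ne p : q%:R * a - p%:R != 0.
  apply/eqP => /eqP; rewrite subr_eq0 => /eqP E; apply: airr.
  apply/rationalP; exists p, q.
  by rewrite -pmulrn -E mulrC mulKf// pnatr_eq0 -lt0n.
set x := q%:R * a; have /truncn_itv/andP[t0 t1] : 0 <= x by rewrite mulr_ge0.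
exists (Num.min (x - (Num.truncn x)%:R) ((Num.truncn x).+1%:R - x)).
  by rewrite lt_min !subr_gt0 t1 andbT lt_neqAle t0 andbT -subr_eq0 -opprB oppr_eq0 ne.
move=> p; rewrite ge_min; case: (leqP p (Num.truncn x)) => pt.
  have : p%:R <= (Num.truncn x)%:R :> R by rewrite ler_nat.
  by move=> ?; rewrite ger0_norm; [apply/orP; left|]; lra.
have : (Num.truncn x).+1%:R <= p%:R :> R by rewrite ler_nat.
by move=> ?; rewrite ltr0_norm; [apply/orP; right|]; lra.
Qed.

(** The finitely many denominators [q <= n] leave [q a] at a distance bounded below
    from the naturals, so a good enough approximation has a larger denominator. *)
Lemma dirichlet_large a n : 0 <= a -> irrational a ->
  exists q p, [/\ (n < q)%N, coprime p q & `|q%:R * a - p%:R| <= q%:R^-1].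
Proof.
move=> a0 airr.
have [e e0 eP] : exists2 e, 0 < e & forall q p, (0 < q)%N -> (q <= n)%N ->
    e <= `|q%:R * a - p%:R|.
  elim: n => [|n [e e0 eP]]; first by exists 1 => // q p; case: q.
  have [e' e'0 e'P] := irrational_mul_nat_dist a0 airr (ltn0Sn n).
  exists (Num.min e e'); first by rewrite lt_min e0.
  move=> q p q0; rewrite ge_min leq_eqVlt => /orP[/eqP->|qn].
    by rewrite e'P orbT.
  by rewrite eP.
pose m := (Num.truncn e^-1).+1.
have [q [p [q0 qm pq qp]]] := dirichlet_coprime a0 (ltn0Sn m.-1).
exists q, p; split => //; last first.
  by rewrite (le_trans (ltW qp))// lef_pV2 ?posrE ?ltr0n// ler_nat.
rewrite ltnNge; apply/negP => qn; have := le_lt_trans (eP q p q0 qn) qp.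
apply/negP; rewrite -leNgt invf_ple ?posrE ?ltr0n//.
by have /truncn_itv/andP[_ /ltW] : 0 <= e^-1 by rewrite invr_ge0 ltW.
Qed.
End dirichlet.

(** * The circle *)

Section circle_facts.
Variable R : realType.
Implicit Types x y : R.

Lemma circle_piD x y : circle_pi (x + y) = circle_pi x + circle_pi y.
Proof. exact: (@pi_addr _ _ _ _ _ (Quotient.quot (integers R))). Qed.

Lemma circle_piB x y : circle_pi (x - y) = circle_pi x - circle_pi y.
Proof. by apply: (addIr (circle_pi y)); rewrite -circle_piD !subrK. Qed.

Lemma circle_pi_eq x y : reflect (circle_pi x = circle_pi y) (x - y \is a Num.int).
Proof.
have E := Quotient.idealrBE (integers R) x y.
apply: (iffP idP) => [xy|xy]; first exact: (elimT eqP (etrans (esym E) xy)).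
by suff : x - y \in integers R by []; rewrite E; apply/eqP.
Qed.

Lemma circle_piK (c : circle R) : circle_pi (repr c) = c.
Proof. exact: reprK. Qed.

Lemma circle_pi_surj (c : circle R) : exists2 x, 0 <= x < 1 & circle_pi x = c.
Proof.
exists (repr c - (Num.floor (repr c))%:~R).
  by rewrite subr_ge0 floor_le ltrBlDl -intrD1 floorD1_gt.
rewrite -[RHS]circle_piK; apply/circle_pi_eq.
by rewrite addrAC subrr add0r rpredN intr_int.
Qed.

Lemma continuous_circle_pi : continuous (@circle_pi R).
Proof. exact: pi_continuous. Qed.
End circle_facts.

(** * Compactness and continuity *)

(** This is the uniform version of the Lebesgue number lemma, stated for a
    relation that holds locally.  The first argument of [Q] is constrained to
    [A], the second one may leave it. *)
Lemma lebesgue_number (R : realType) (X : pseudoMetricType R) (A : set X)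
    (Q : X -> X -> Prop) : compact A ->
  (forall u, A u -> \forall v \near u & w \near u, Q v w) ->
  exists2 e : R, 0 < e & forall u v, A u -> ball u e v -> Q u v.
Proof.
move=> /compact_near_coveringP cA QA.
pose P (e : R) (u : X) := forall v, ball u e v -> Q u v.
have : \forall e \near (0:R)^'+, A `<=` P e.
  apply: cA => u /QA [[V W] [/= /nbhs_ballP[r r0 rV] /nbhs_ballP[s s0 sW]] VW].
  exists (ball u (Num.min r (s / 2)), [set e | e < s / 2]) => /=.
    split; first by apply: nbhsx_ballx; rewrite lt_min r0 divr_gt0.
    by apply: nbhs_right_lt; rewrite divr_gt0.
  move=> [v e] [/= uv es] w vw; apply: (VW (v, w)); split => /=.
    by apply/rV/(le_ball _ uv); rewrite ge_min lexx.
  apply: sW; apply: (@ball_split _ _ v).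
    by apply: (le_ball _ uv); rewrite ge_min lexx orbT.
  exact/(le_ball _ vw)/ltW.
move=> near_e; have [e [e0 eA]] := filter_ex (filterI (@nbhs_right_gt R 0) near_e).
by exists e => // u v /eA; apply.
Qed.

Lemma continuous_pair (X Y Z : topologicalType) (f : Z -> X) (g : Z -> Y) (z : Z) :
  {for z, continuous f} -> {for z, continuous g} ->
  {for z, continuous (fun z => (f z, g z))}.
Proof. by move=> cf cg; apply: cvg_pair; [exact: cf|exact: cg]. Qed.

Lemma continuous_within_setX_slice (X Y Z : topologicalType) (A : set X)
    (H : X * Y -> Z) (t : X) : {within A `*` setT, continuous H} -> A t ->
  continuous (fun y => H (t, y)).
Proof.
move=> /subspace_continuousP cH At y U /(cH (t, y) (conj At Logic.I)) HU.
have ty : {for y, continuous (fun y' : Y => (t, y'))}.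
  by apply: continuous_pair; [exact: cst_continuous|exact: cvg_id].
have := ty _ HU; rewrite /nbhs/=; apply: filterS => y' /=; exact.
Qed.

(** * Lifting maps of the circle to the line *)

Section circle_trigo.
Variable R : realType.
Implicit Types x y : R.

Definition two_pi : R := pi *+ 2.

(** The cosine and the sine of the angle of a point embed the circle in the plane;
    they reduce the continuity of differences of circle-valued maps to that of
    real functions. *)
Definition cosc (c : circle R) : R := cos (two_pi * repr c).
Definition sinc (c : circle R) : R := sin (two_pi * repr c).

Lemma periodic1_cos : periodic1 (fun x => cos (two_pi * x)).
Proof. by move=> x; rewrite mulrDr mulr1 cosD2pi. Qed.

Lemma periodic1_sin : periodic1 (fun x => sin (two_pi * x)).
Proof. by move=> x; rewrite mulrDr mulr1 sinD2pi. Qed.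

Lemma periodic1_repr (f : R -> R) x : periodic1 f -> f (repr (circle_pi x)) = f x.
Proof.
move=> fP; have /circle_pi_eq/intrP[m E] := circle_piK (circle_pi x).
by rewrite -(subrK x (repr _)) E addrC periodic1_int.
Qed.

Lemma periodic1_continuous (f : R -> R) : periodic1 f -> continuous f ->
  continuous (fun c : circle R => f (repr c)).
Proof.
move=> fP fc; apply/quotient_continuous.
have -> : (fun c : circle R => f (repr c)) \o \pi_(circle R)%qT = f; last by [].
by apply/funext => x; exact: periodic1_repr.
Qed.

Lemma continuous_cosc : continuous cosc.
Proof.
apply: (periodic1_continuous periodic1_cos) => x.
by apply: continuous_comp; [exact: mulrl_continuous|exact: continuous_cos].
Qed.

Lemma continuous_sinc : continuous sinc.
Proof.
apply: (periodic1_continuous periodic1_sin) => x.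
by apply: continuous_comp; [exact: mulrl_continuous|exact: continuous_sin].
Qed.

(** The angle is measured in full turns, so that [circle_pi] maps it to the point. *)
Definition signed_angle (c s : R) : R := atan (s / c) / two_pi.

(** With positive cosine, the angle can be reduced modulo a full turn to the range
    in which the arctangent inverts the tangent. *)
Lemma circle_pi_signed_angle x : 0 < cos (two_pi * x) ->
  circle_pi (signed_angle (cos (two_pi * x)) (sin (two_pi * x))) = circle_pi x.
Proof.
pose m := Num.floor (x + 2^-1); pose y := x - m%:~R.
have -> : circle_pi x = circle_pi y.
  by apply/circle_pi_eq; rewrite opprB addrC subrK intr_int.
have -> : cos (two_pi * x) = cos (two_pi * y).
  by rewrite -(periodic1_int periodic1_cos y m) subrK.
have -> : sin (two_pi * x) = sin (two_pi * y).
  by rewrite -(periodic1_int periodic1_sin y m) subrK.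
have p0 := pi_gt0 R.
have : -2^-1 <= y < 2^-1.
  have := floor_itv (x + 2^-1); rewrite -/m intrD1 => /andP[? ?].
  by apply/andP; split; rewrite /y; lra.
move: y => {x m} y /andP[y1 y2] cy.
have yh : `|two_pi * y| < pi / 2.
  have : cos (pi / 2) < cos `|two_pi * y| by rewrite cos_pihalf cos_norm.
  rewrite ltr_cos// in_itv/=; apply/andP; split; rewrite ?normr_ge0//; try lra.
  by rewrite ler_norml /two_pi mulr2n; apply/andP; split; nra.
rewrite /signed_angle -/(tan _) tanK; last by rewrite in_itv/= -ltr_norml.
by rewrite mulrC mulKf// mulrn_eq0/= gt_eqF.
Qed.

Definition lifts (X : topologicalType) (f : X -> circle R) :=
  exists2 g : X -> R, continuous g & forall z, circle_pi (g z) = f z.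

(** The cosine and the sine of the difference [f2 - f1] are continuous and the
    former is positive, so the difference has a continuous angle, which is added
    to the lift of [f1]. *)
Lemma lifts_near (X : topologicalType) (f1 f2 : X -> circle R) :
  continuous f1 -> continuous f2 ->
  (forall z, 0 < cosc (f2 z) * cosc (f1 z) + sinc (f2 z) * sinc (f1 z)) ->
  lifts f1 -> lifts f2.
Proof.
move=> cf1 cf2 f12 [g cg gE].
pose C z := cosc (f2 z) * cosc (f1 z) + sinc (f2 z) * sinc (f1 z).
pose S z := sinc (f2 z) * cosc (f1 z) - cosc (f2 z) * sinc (f1 z).
exists (fun z => g z + signed_angle (C z) (S z)); last first.
  move=> z; rewrite circle_piD gE.
  have CE : C z = cos (two_pi * (repr (f2 z) - repr (f1 z))) by rewrite mulrBr cosB.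
  have SE : S z = sin (two_pi * (repr (f2 z) - repr (f1 z))) by rewrite mulrBr sinB.
  rewrite CE SE circle_pi_signed_angle -?CE; last exact: f12.
  by rewrite circle_piB !circle_piK addrC subrK.
have [c1 s1] : continuous (cosc \o f1) /\ continuous (sinc \o f1).
  by split=> z; apply: continuous_comp; [exact: cf1|exact: continuous_cosc|exact: cf1|exact: continuous_sinc].
have [c2 s2] : continuous (cosc \o f2) /\ continuous (sinc \o f2).
  by split=> z; apply: continuous_comp; [exact: cf2|exact: continuous_cosc|exact: cf2|exact: continuous_sinc].
move=> z; apply: cvgD; first exact: cg.
apply: cvgM; last exact: cvg_cst.
apply: (@continuous_comp _ _ _ (fun z => S z / C z) atan); last exact: continuous_atan.
apply: cvgM; last apply: cvgV.
- by apply: cvgB; apply: cvgM; [exact: s2|exact: c1|exact: c2|exact: s1].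
- by rewrite gt_eqF// f12.
- by apply: cvgD; apply: cvgM; [exact: c2|exact: c1|exact: s2|exact: s1].
Qed.

(** A constant map lifts.  By uniform continuity on a compact rectangle the
    homotopy can be cut into [K] steps at which both coordinates in the plane move
    by less than 1; two unit vectors at such a distance have a positive scalar
    product, so [lifts_near] carries a lift from each step to the preceding one. *)
Lemma homotopically_trivial_lifts (h : circle R -> circle R) :
  homotopically_trivial R h -> lifts h.
Proof.
move=> [c [H [cH H0 H1]]].
have cHA := iffLR (subspace_continuousP _ _) cH.
have cHt t : 0 <= t <= 1 -> continuous (fun z => H (t, z)).
  by move=> t01; apply: (continuous_within_setX_slice cH); rewrite /= in_itv.
pose F (u : R * R) := cosc (H (u.1, circle_pi u.2)).
pose G (u : R * R) := sinc (H (u.1, circle_pi u.2)).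
pose A := `[0, 1]%classic `*` `[0, 1]%classic : set (R * R).
pose Q (u v : R * R) := 0 <= u.1 <= 1 -> 0 <= v.1 <= 1 ->
  `|F u - F v| < 1 /\ `|G u - G v| < 1.
have near_half (f : circle R -> R) u : continuous f -> A u ->
    \forall v \near u, 0 <= v.1 <= 1 ->
      `|f (H (u.1, circle_pi u.2)) - f (H (v.1, circle_pi v.2))| < 1 / 2.
  move=> cf [u1 u2].
  have /cvgrPdist_lt : f \o H @ within (`[0, 1] `*` setT) (nbhs (u.1, circle_pi u.2)) -->
      f (H (u.1, circle_pi u.2)).
    exact: (cvg_comp _ f (cHA (u.1, circle_pi u.2) (conj u1 Logic.I)) (cf _)).
  have h0 : 0 < 1 / 2 :> R by lra.
  move=> /(_ _ h0) fH.
  have pu : continuous_at u (fun v => (v.1, circle_pi v.2)).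
    apply: continuous_pair; first exact: cvg_fst.
    apply: (@continuous_comp _ _ _ snd (@circle_pi R)); first exact: cvg_snd.
    exact: continuous_circle_pi.
  by have := pu _ fH; rewrite /nbhs/=; apply: filterS => v /= + v01; apply; split => //=; rewrite in_itv.
have [||e e0 eQ] := @lebesgue_number _ _ A Q.
- by apply: compact_setX; exact: segment_compact.
- move=> u Au.
  have near_u := filterI (near_half _ _ continuous_cosc Au) (near_half _ _ continuous_sinc Au).
  move/(_ (nbhs_filter _)): near_u; set B := (X in nbhs u X) => near_u.
  exists (B, B); first by split; exact: near_u.
  move=> [v w]/= [[vc vs] [wc ws]] v01 w01.
  have := vc v01; have := vs v01; have := wc w01; have := ws w01; rewrite /F /G.
  rewrite !ltr_norml => /andP[? ?] /andP[? ?] /andP[? ?] /andP[? ?].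
  by split; apply/andP; split; lra.
pose K := (Num.truncn e^-1).+1.
have K0 : 0 < K%:R :> R by rewrite ltr0n.
have Ke : K%:R^-1 < e.
  rewrite invf_plt ?posrE//.
  by have /truncn_itv/andP[] : 0 <= e^-1 by rewrite invr_ge0 ltW.
suff hK k : (k <= K)%N -> lifts (fun z => H (k%:R / K%:R, z)) -> lifts h.
  apply: (hK K) => //; rewrite mulfV ?gt_eqF//.
  exists (fun=> repr c); first exact: cst_continuous.
  by move=> z; rewrite H1 circle_piK.
elim: k => [_|k IH kK Hk].
  rewrite mul0r. have -> // : (fun z => H (0, z)) = h by apply/funext.
apply: IH; first exact: ltnW.
have k01 i : (i <= K)%N -> 0 <= (i%:R / K%:R : R) <= 1.
  by move=> iK; rewrite divr_ge0//= ler_pdivrMr// mul1r ler_nat.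
apply: lifts_near Hk; [exact/cHt/k01|exact/cHt/k01/ltnW|] => z.
have [x x01 <-] := circle_pi_surj z.
have [||||] := eQ (k%:R / K%:R, x) (k.+1%:R / K%:R, x).
- by split => /=; rewrite in_itv//=; [exact/k01/ltnW|case/andP: x01 => -> /ltW].
- split; last exact: ballxx.
  rewrite /ball/= distrC -mulrBl -natrB// subSnn mul1r.
  by rewrite ger0_norm// invr_ge0.
- exact/k01/ltnW.
- exact: k01.
rewrite /F /G/=; set a := H _; set b := H _ => + +.
have := cos2Dsin2 (two_pi * repr a); have := cos2Dsin2 (two_pi * repr b).
rewrite -/(cosc _) -/(cosc _) -/(sinc _) -/(sinc _).
rewrite !ltr_norml => ? ? /andP[? ?] /andP[? ?].
nra.
Qed.
End circle_trigo.

Section smooth.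
Variable R : realType.
Implicit Types (f g : R -> R) (x y : R).

Lemma near_derive1n_addC f g x c : (\forall y \near x, g y = f y + c) ->
  (\forall y \near x, forall k, derivable (derive1n k f) y 1) ->
  forall k, \forall y \near x, derive1n k g y =
    derive1n k f y + (if k == 0%N then c else 0).
Proof.
move=> gf df; elim=> [|k /nbhs_interior IH].
  by apply: filterS gf => y; rewrite !derive1n0.
apply: filterS2 IH df => y gfy dfy; rewrite addr0 !derive1nS !derive1E.
set d := (if _ then _ else _) in gfy.
rewrite (@near_eq_derive _ _ _ _ (derive1n k f + cst d)); last exact: gfy.
by rewrite deriveD// derive_cst addr0.
Qed.

Lemma near_smooth_addC f g x c : (\forall y \near x, g y = f y + c) ->
  (\forall y \near x, forall k, derivable (derive1n k f) y 1) ->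
  forall k, derivable (derive1n k g) x 1.
Proof.
move=> gf df k; have := near_derive1n_addC gf df k.
set d := (if _ then _ else _) => gfk.
apply: (@near_eq_derivable _ _ _ (derive1n k f + cst d)); last first.
  by apply: derivableD => //; exact: (nbhs_singleton df).
by apply: filterS gfk => y ->.
Qed.

(** Distinct integers are at distance at least 1. *)
Lemma near_integer_cst (u : R -> R) x : {for x, continuous u} ->
  (\forall y \near x, u y \is a Num.int) -> \forall y \near x, u y = u x.
Proof.
move=> /cvgrPdist_lt/(_ 1 ltr01) ux ui.
have xi := nbhs_singleton ui.
apply: filterS2 ux ui => y yx yi; apply/eqP; rewrite eq_sym -subr_eq0.
by apply: contraTT yx => ne; rewrite -leNgt norm_intr_ge1// rpredB.
Qed.

Lemma periodic1_derive1n f k : periodic1 f -> periodic1 (derive1n k f).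
Proof.
move=> fP; elim: k => // k IH x; rewrite derive1nS.
rewrite !derive1E /derive (_ : (fun h => _) =
  (fun h => h^-1 *: ((derive1n k f \o shift x) (h *: 1) - derive1n k f x))) //.
by apply/funext => h /=; rewrite IH addrA IH.
Qed.

Lemma periodic1_bounded f : periodic1 f -> continuous f ->
  exists B, forall x, `|f x| <= B.
Proof.
move=> fP fc; have fc01 : {within `[0, 1], continuous f} by exact: continuous_subspaceT.
have [c _ cP] := EVT_max ler01 fc01; have [d _ dP] := EVT_min ler01 fc01.
exists (Num.max (f c) (- f d)) => x.
have -> : f x = f (x - (Num.floor x)%:~R).
  by rewrite -[RHS](periodic1_int fP _ (Num.floor x)) subrK.
have x01 : x - (Num.floor x)%:~R \in `[0, 1].
  rewrite in_itv/= subr_ge0 floor_le/= lerBlDl; apply: ltW.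
  by rewrite -intrD1 floorD1_gt.
by rewrite ler_norml lerNl !le_max lerN2 cP// dP// orbT.
Qed.

(** Near each point the continuous lift differs from a smooth local lift by a
    continuous function with integer values, hence by a constant. *)
Lemma smooth_real_lift (h : circle R -> circle R) :
  homotopically_trivial R h -> circle_smooth h ->
  exists g, [/\ periodic1 g, forall k x, derivable (derive1n k g) x 1 &
     forall x, circle_pi (g x) = h (circle_pi x)].
Proof.
move=> /homotopically_trivial_lifts[G cG GE] hs.
exists (G \o @circle_pi R); split=> [x|k x|x]; last exact: GE.
  rewrite /=; congr G; apply/circle_pi_eq.
  by rewrite addrC addKr.
have [f [hf df]] := hs x.
have cf : {for x, continuous f}.
  apply: differentiable_continuous; apply/derivable1_diffP.
  exact: (nbhs_singleton df 0%N).
have cg : {for x, continuous (G \o @circle_pi R)}.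
  by apply: continuous_comp; [exact: continuous_circle_pi|exact: cG].
have cu : {for x, continuous (fun y => G (circle_pi y) - f y)}.
  by apply: cvgB; [exact: cg|exact: cf].
apply: (@near_smooth_addC f _ x (G (circle_pi x) - f x)) => //.
have ui : \forall y \near x, G (circle_pi y) - f y \is a Num.int.
  by apply: filterS hf => y hfy; apply/circle_pi_eq; rewrite GE.
by apply: filterS (near_integer_cst cu ui) => y <- /=; rewrite addrC subrK.
Qed.
End smooth.

(** * The torus and the complexity *)

Section torus.
Variable R : realType.
Implicit Types (x y e : R).

Definition torus_pi (u : R * R) : circle R * circle R := (circle_pi u.1, circle_pi u.2).

Lemma torus_pi_int u (m n : int) : torus_pi (u.1 + m%:~R, u.2 + n%:~R) = torus_pi u.
Proof. by congr (_, _); apply/circle_pi_eq; rewrite addrC addKr intr_int. Qed.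

Lemma continuous_torus_pi : continuous torus_pi.
Proof.
move=> u; apply: (@continuous_pair (circle R) (circle R) _ (fun v => circle_pi v.1)
  (fun v => circle_pi v.2) u).
  apply: (@continuous_comp _ _ _ fst (@circle_pi R)); first exact: cvg_fst.
  exact: continuous_circle_pi.
apply: (@continuous_comp _ _ _ snd (@circle_pi R)); first exact: cvg_snd.
exact: continuous_circle_pi.
Qed.

(** The projection of the plane to the torus is uniformly continuous: it is so near
    the unit square by compactness, and integer translations cover the plane. *)
Lemma compatible_metric_uniform (d : circle R * circle R -> circle R * circle R -> R) e :
  compatible_metric d -> 0 < e ->
  exists2 r : R, 0 < r & forall u v : R * R, `|u.1 - v.1| < r -> `|u.2 - v.2| < r ->
    d (torus_pi u) (torus_pi v) < e.
Proof.
move=> dm e0.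
pose A := `[0, 1]%classic `*` `[0, 1]%classic : set (R * R).
pose Q (u v : R * R) := d (torus_pi u) (torus_pi v) < e.
have [|u _|r r0 rQ] := @lebesgue_number R (R * R)%type A Q.
- by apply: compact_setX; exact: segment_compact.
- pose B := [set q | d (torus_pi u) q < e / 2].
  have uB : nbhs u (torus_pi @^-1` B).
    apply: continuous_torus_pi; apply/(compatible_metric_nbhs dm).
    by exists (e / 2) => //; rewrite divr_gt0.
  exists (torus_pi @^-1` B, torus_pi @^-1` B) => //.
  move=> [v w] [/= vB wB]; rewrite /Q (splitr e).
  apply: (le_lt_trans (compatible_metric_triangle dm _ (torus_pi u) _)).
  by rewrite ltrD// (compatible_metric_sym dm).
exists r => // u v uv1 uv2.
pose m : int := - Num.floor u.1; pose n : int := - Num.floor u.2.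
rewrite -(torus_pi_int u m n) -(torus_pi_int v m n); apply: rQ.
  split => /=; rewrite in_itv/= rmorphN/= subr_ge0 floor_le/= lerBlDl -intrD1;
  exact/ltW/floorD1_gt.
by split; rewrite /ball/= opprD addrACA subrr addr0.
Qed.

Lemma iter_skew_product (alpha : R) h g x y i :
  (forall z, circle_pi (g z) = h (circle_pi z)) ->
  iter i (skew_product alpha h) (torus_pi (x, y)) =
  torus_pi (x + i%:R * alpha, y + birkhoff alpha g i x).
Proof.
move=> gh; elim: i => [|i IH].
  by rewrite /birkhoff big_ord0 mul0r !addr0.
rewrite iterS IH /skew_product /torus_pi/= -gh -!circle_piD.
by rewrite -[i.+1]addn1 birkhoffD natrD mulrDl mul1r !addrA /birkhoff big_ord1 mul0r addr0.
Qed.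

Lemma complexity_ge0 (X : ptopologicalType) (T : X -> X) (d : X -> X -> R) rho n e :
  (0 <= complexity T d rho n e)%E.
Proof. by apply: le_ereal_inf_tmp => _ [m _ <-]; rewrite lee_fin. Qed.

(** A cover of the whole space serves every probability, and closeness at each
    time implies closeness in the mean. *)
Lemma complexity_cover (X : ptopologicalType) (T : X -> X) (d : X -> X -> R)
    (rho : probability (borel X) R) n e m (c : 'I_m -> X) :
  (0 < m)%N -> (0 < n)%N -> 0 < e ->
  (forall z, exists k, forall i, (i < n)%N -> d (iter i T (c k)) (iter i T z) < e) ->
  (complexity T d rho n e <= m%:R%:E)%E.
Proof.
move=> m0 n0 e0 cP; apply: ereal_inf_lbound; exists m => //; split => //.
exists c; rewrite (_ : \bigcup_i _ = setT).
  by rewrite probability_setT lte_fin ltrBlDr ltrDl.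
apply/seteqP; split => // z _; have [k kP] := cP z; exists k => //.
rewrite /mean_ball/= /mean_dist mulrC ltr_pdivrMr ?ltr0n// mulr_natr.
rewrite -[n in ltRHS]card_ord -sumr_const.
apply: ltr_sum; last by move=> i _; exact: kP.
by apply/hasP; exists (Ordinal n0); rewrite // mem_index_enum.
Qed.

Lemma limn_einf_eq0 (u : nat -> \bar R) : (forall n, (0 <= u n)%E) ->
  (forall e N, 0 < e -> exists2 n, (N <= n)%N & (u n <= e%:E)%E) ->
  limn_einf u = 0%E.
Proof.
move=> u0 ue; rewrite limn_einf_lim.
have -> : einfs u = fun=> 0%E; last exact: lim_cst.
apply/funext => N; apply/eqP; rewrite eq_le; apply/andP; split.
  apply/lee_addgt0Pr => e e0; rewrite add0e.
  have [n Nn un] := ue e N e0.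
  by apply: le_trans un; apply: ereal_inf_lbound; exists n.
by apply: le_ereal_inf_tmp => _ [n _ <-].
Qed.

Lemma unit_interval_grid x n : (0 < n)%N -> 0 <= x < 1 ->
  exists2 a, (a < n)%N & `|a%:R / n%:R - x| <= n%:R^-1.
Proof.
move=> n0 /andP[x0 x1]; have n0' : 0 < n%:R :> R by rewrite ltr0n.
have xn0 : 0 <= x * n%:R by rewrite mulr_ge0.
exists (Num.truncn (x * n%:R)); first by rewrite truncn_lt_nat// gtr_pMl.
have /andP[t0 t1] := truncn_itv xn0; move: t0 t1; set t := Num.truncn _.
rewrite -[t.+1]addn1 natrD -ler_pdivrMr// -ltr_pdivlMr// mulrDl mul1r => t0 t1.
by rewrite distrC ger0_norm ?subr_ge0// lerBlDl ltW.
Qed.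

(** The Birkhoff sums of [g] have as derivatives those of [g'], to which
    [norm_birkhoff_tower_le] applies; the exponent [N] in the range of [i] absorbs
    the factor [(2 / q) ^ N] up to a constant. *)
Lemma birkhoff_lipschitz (g : R -> R) N :
  periodic1 g -> (forall k x, derivable (derive1n k g) x 1) ->
  exists2 L, 0 <= L & forall alpha q p i x y, (0 < q)%N -> coprime p q ->
    `|q%:R * alpha - p%:R| <= q%:R^-1 -> (i <= q ^ N)%N ->
    `|birkhoff alpha g i x - birkhoff alpha g i y| <= L * q%:R * `|x - y|.
Proof.
move=> gP gD.
have gI k x : is_derive x 1 (derive1n k g) (derive1n k.+1 g x).
  by apply: DeriveDef; [exact: gD|rewrite derive1nS derive1E].
have gB k : exists B, forall x, `|derive1n k g x| <= B.
  apply: periodic1_bounded; first exact: periodic1_derive1n.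
  by move=> x; apply: differentiable_continuous; apply/derivable1_diffP.
have [[B1 gB1] [B2 gB2]] := (gB 1%N, gB N.+1).
have B1_ge0 : 0 <= B1 by rewrite (le_trans _ (gB1 0)).
have B2_ge0 : 0 <= B2 by rewrite (le_trans _ (gB2 0)).
exists (2 * N%:R * B1 + 2 ^+ N * B2) => [|alpha q p i x y q0 pq aq iq].
  by rewrite addr_ge0// !mulr_ge0// exprn_ge0.
apply: (derive_lipschitz (g := birkhoff alpha (derive1n 1 g) i)).
  by move=> z; apply: is_derive_birkhoff => w; exact: (gI 0%N).
move=> z; have := norm_birkhoff_tower_le i z q0 pq aq
  (fun k => periodic1_derive1n k gP) gI gB1 gB2.
move=> /le_trans; apply; rewrite [leRHS](mulrDl (2 * N%:R * B1)) lerD//.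
  by rewrite [leRHS](_ : _ = 2 * q%:R * N%:R * B1)//; ring.
have q1 : 1 <= q%:R :> R by rewrite ler1n.
rewrite (@le_trans _ _ (2 ^+ N * B2))//.
  rewrite exprMn exprVn mulrA ler_wpM2r//.
  rewrite [leLHS](_ : _ = i%:R / q%:R ^+ N * 2 ^+ N); last by ring.
  rewrite -[leRHS]mul1r ler_wpM2r ?exprn_ge0// ler_pdivrMr ?exprn_gt0 ?ltr0n// mul1r.
  by rewrite -natrX ler_nat.
by rewrite ler_peMr// mulr_ge0// exprn_ge0.
Qed.

(** The centers form a grid with mesh [1 / (q K)] in the first coordinate and
    [1 / K] in the second.  Along the orbits the first mesh does not grow and the
    second one grows to at most [1 / K + L q / (q K) = (1 + L) / K]. *)
Lemma skew_product_complexity_le (h : circle R -> circle R) (g : R -> R) N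
    (d : circle R * circle R -> circle R * circle R -> R) e :
  (forall z, circle_pi (g z) = h (circle_pi z)) ->
  periodic1 g -> (forall k x, derivable (derive1n k g) x 1) ->
  compatible_metric d -> 0 < e ->
  exists C, forall alpha rho q p, (0 < q)%N -> coprime p q ->
    `|q%:R * alpha - p%:R| <= q%:R^-1 ->
    (complexity (skew_product alpha h) d rho (q ^ N) e <= (q * C)%:R%:E)%E.
Proof.
move=> gh gP gD dm e0; have [r r0 rP] := compatible_metric_uniform dm e0.
have [L L0 LP] := birkhoff_lipschitz N gP gD.
pose K := (Num.truncn ((1 + L) / r)).+1.
have K0 : 0 < K%:R :> R by rewrite ltr0n.
have Kr : (1 + L) / K%:R < r.
  rewrite ltr_pdivrMr// mulrC -ltr_pdivrMr//.
  by have /truncn_itv/andP[] : 0 <= (1 + L) / r by rewrite divr_ge0 ?addr_ge0// ltW.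
exists (K * K)%N => alpha rho q p q0 pq aq.
have qK0 : (0 < q * K)%N by rewrite muln_gt0 q0.
pose c (k : 'I_(q * (K * K))) : circle R * circle R :=
  torus_pi ((k %/ K)%:R / (q * K)%:R, (k %% K)%:R / K%:R).
apply: (@complexity_cover _ _ _ _ _ _ _ c) => //.
- by rewrite mulnA muln_gt0 qK0.
- by rewrite expn_gt0 q0.
move=> [z1 z2]; have [x x01 <-] := circle_pi_surj z1.
have [y y01 <-] := circle_pi_surj z2.
have [a aqK ax] := unit_interval_grid qK0 x01.
have [b bK bP] := unit_interval_grid (ltn0Sn _ : (0 < K)%N) y01.
have kK : (a * K + b < q * (K * K))%N.
  by rewrite mulnA (@leq_trans (a.+1 * K))// ?leq_mul2r ?aqK ?orbT// mulSn addnC ltn_add2r.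
exists (Ordinal kK) => i iq; rewrite /c/= divnMDl// divn_small// addn0.
rewrite modnMDl modn_small// -[(circle_pi x, circle_pi y)]/(torus_pi (x, y)).
rewrite !(iter_skew_product _ _ _ _ gh); apply: rP => /=.
  rewrite opprD addrACA subrr addr0 (le_lt_trans ax)//.
  apply: le_lt_trans Kr; rewrite -[leLHS]mul1r ler_pM ?invr_ge0 ?lerDl//.
  by rewrite lef_pV2 ?posrE ?ltr0n// ler_nat leq_pmull.
rewrite opprD addrACA (le_lt_trans (ler_normD _ _))//.
apply: le_lt_trans Kr; rewrite mulrDl mul1r lerD//.
apply: le_trans (LP _ _ _ _ _ _ q0 pq aq (ltnW iq)) _.
rewrite (le_trans (ler_wpM2l _ ax)) ?mulr_ge0// natrM invfM -!mulrA mulVKf//.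
by rewrite pnatr_eq0 -lt0n.
Qed.
End torus.

(** * Sub-polynomial complexity *)

Theorem theorem1p3 (R : realType) (alpha : R) (h : circle R -> circle R)
  (alpha_ge0 : 0 <= alpha) (alpha_lt1 : alpha < 1)
  (alpha_irr : irrational alpha)
  (h_trivial : homotopically_trivial R h) (h_smooth : circle_smooth h)
  (rho : probability (borel (circle R * circle R)%type) R)
  (rho_inv : invariant_measure (skew_product alpha h) rho) :
  sub_polynomial_complexity (skew_product alpha h) rho.
Proof.
move=> t t0 d dm e e0; have [g [gP gD gh]] := smooth_real_lift h_trivial h_smooth.
pose N := (Num.truncn (2 / t)).+1.
have Nt : 2 <= N%:R * t.
  rewrite -ler_pdivrMr// ltW//.
  by have /truncn_itv/andP[] : 0 <= 2 / t by rewrite divr_ge0// ltW.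
have [C CP] := skew_product_complexity_le N gh gP gD dm e0.
apply: limn_einf_eq0 => [n|e' n0 e'0].
  by rewrite mule_ge0 ?complexity_ge0// lee_fin invr_ge0 powR_ge0.
have [q [p [qn pq aq]]] := dirichlet_large (maxn n0 (Num.truncn (C%:R / e')).+1)
  alpha_ge0 alpha_irr.
have q0 : (0 < q)%N by rewrite (leq_trans _ qn).
have q0' : 0 < q%:R :> R by rewrite ltr0n.
exists (q ^ N)%N.
  rewrite (leq_trans (leq_trans (leq_maxl _ _) (ltnW qn)))//.
  by rewrite -{1}[q]expn1 leq_pexp2l.
have qNt : q%:R ^+ 2 <= (q ^ N)%:R `^ t :> R.
  by rewrite natrX -!powR_mulrn// -powRrM ler_powR// ler1n.
apply: (@le_trans _ _ ((q * C)%:R%:E * (q%:R ^- 2)%:E)%E).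
  apply: lee_pmul; rewrite ?complexity_ge0 ?lee_fin ?invr_ge0 ?powR_ge0//.
    exact: CP pq aq.
  by rewrite lef_pV2// posrE ?exprn_gt0// (lt_le_trans _ qNt)// exprn_gt0.
rewrite -EFinM lee_fin natrM ler_pdivrMr ?exprn_gt0// mulrC expr2 mulrA ler_pM2r//.
rewrite mulrC -ler_pdivrMr// (le_trans (ltW (_ : _ < (Num.truncn (C%:R / e')).+1%:R)))//.
  by have /truncn_itv/andP[] : 0 <= C%:R / e' by rewrite divr_ge0// ltW.
by rewrite ler_nat ltnW// (leq_ltn_trans _ qn)// leq_maxr.
Qed.
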